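(* Let $(W,S)$ be a Coxeter system with $S$ finite. For each cone type $T\in\mathbb{T}$ and each $\beta\in\partial T$ there is a unique minimal length element $y_\beta\in W$ such that $$\Phi(x)\cap\Phi(y_\beta)=\{\beta\}\quad\text{for all }x\in Q(T).$$ Moreover, $\Phi^R(y_\beta)=\{\beta\}$, and for each $x\in Q(T)$ we have $y_\beta\preceq y$ for all $y\in\partial T(x^{-1})_\beta$. Thus $y_\beta\preceq y$ for all $y\in\partial T_\beta$.
   Context: $(W,S)$ is a Coxeter system with $S$ finite and $\ell$ is the word length with respect to $S$. $V$ is the real vector space with basis $\{\alpha_s\mid s\in S\}$ and symmetric bilinear form $\langle\alpha_s,\alpha_t\rangle=-\cos(\pi/m(s,t))$ (equal to $-1$ if $m(s,t)=\infty$); $W$ acts on $V$ by $sv=v-2\langle v,\alpha_s\rangle\alpha_s$. The root system is $\Phi=\{w\alpha_s\mid w\in W,s\in S\}=\Phi^+\sqcup\Phi^-$ (positive and negative roots). The (left) inversion set of $w\in W$ is $\Phi(w)=\{\alpha\in\Phi^+\mid w^{-1}\alpha\in\Phi^-\}$. Right weak order: $x\preceq y$ iff $\ell(y)=\ell(x)+\ell(x^{-1}y)$. Right descent set: $D_R(w)=\{s\in S\mid\ell(ws)=\ell(w)-1\}$; right-descent roots: $\Phi^R(w)=\{-w\alpha_s\mid s\in D_R(w)\}$. Cone type of $w$: $T(w)=\{v\in W\mid\ell(wv)=\ell(w)+\ell(v)\}$; $\mathbb{T}=\{T(w)\mid w\in W\}$. For $T\in\mathbb{T}$ the cone type part is $Q(T)=\{x\in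 W\mid T(x^{-1})=T\}$. The boundary roots of $T$ are $\partial T=\{\beta\in\Phi^+\mid\exists\,y\in W,\ \Phi(x)\cap\Phi(y)=\{\beta\}\}$, where $x$ is any element of $Q(T)$ (it is known that this set does not depend on the choice of $x\in Q(T)$). For $x\in W$ and $\beta\in\Phi^+$: $\partial T(x^{-1})_\beta=\{y\in W\mid\Phi(x)\cap\Phi(y)=\{\beta\}\}$. For $T\in\mathbb{T}$ and $\beta\in\partial T$: $\partial T_\beta=\{y\in W\mid\Phi(x)\cap\Phi(y)=\{\beta\}\text{ for all }x\in Q(T)\}=\bigcap_{x\in Q(T)}\partial T(x^{-1})_\beta$. *)

(* Defs.v *)
(* Built on MathComp and MathComp-Analysis. *)
From HB Require Import structures.
From mathcomp Require Import all_boot all_order all_algebra.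
From mathcomp Require Import ring lra.
From mathcomp Require Import boolp classical_sets reals trigo.

Set Implicit Arguments.
Unset Strict Implicit.
Unset Printing Implicit Defensive.

Import Order.TTheory GRing.Theory Num.Theory.

Local Open Scope classical_set_scope.
Local Open Scope ring_scope.

(** ** Group presentations *)

Section Presentation.
Variables (S : Type) (rel : seq (S * bool) -> Prop).

(* The letter (s, false) stands for s and (s, true) for its formal inverse.
   The classes of [pres_cong] are the elements of the group < S | rel >. *)
Inductive pres_cong : seq (S * bool) -> seq (S * bool) -> Prop :=
| PresRefl u : pres_cong u u
| PresSym u v : pres_cong u v -> pres_cong v u
| PresTrans u v w : pres_cong u v -> pres_cong v w -> pres_cong u w
| PresCancel u s b v : pres_cong (u ++ [:: (s, b); (s, ~~ b)] ++ v) (u ++ v)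
| PresRel u r v : rel r -> pres_cong (u ++ r ++ v) (u ++ v).

Definition pres_eval (W : groupType) (f : S -> W) (u : seq (S * bool)) : W :=
  (\prod_(x <- u) (if x.2 then (f x.1)^-1 else f x.1))%g.

Definition is_presented (W : groupType) (f : S -> W) : Prop :=
  (forall w : W, exists u, pres_eval f u = w) /\
  (forall u v, pres_eval f u = pres_eval f v <-> pres_cong u v).

End Presentation.

(** ** Coxeter systems *)

(* The value 0 of the Coxeter matrix encodes m(s, t) = oo: the corresponding
   relator below is then the empty word. *)
Definition coxeter_relator (S : Type) (m : S -> S -> nat) (r : seq (S * bool)) :
    Prop :=
  exists s t, r = flatten (nseq (m s t) [:: (s, false); (t, false)]).

Record coxeterSystem := CoxeterSystem {
  cox_group :> groupType;
  cox_gens : finType;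
  cox_m : cox_gens -> cox_gens -> nat;
  cox_gen : cox_gens -> cox_group;
  cox_m_diag : forall s, cox_m s s = 1%N;
  cox_m_sym : forall s t, cox_m s t = cox_m t s;
  cox_m_offdiag : forall s t, s != t -> cox_m s t != 1%N;
  cox_presented : is_presented (coxeter_relator cox_m) cox_gen
}.

Section CoxeterGroup.
Variable C : coxeterSystem.
Implicit Types (w x y v : C) (s t : cox_gens C).

Definition word_eval (u : seq (cox_gens C)) : C :=
  (\prod_(s <- u) cox_gen s)%g.

Lemma cox_genK s : (cox_gen s * cox_gen s = 1)%g.
Proof.
have [_ /(_ [:: (s, false); (s, false)] [::]) [_]] := cox_presented C.
rewrite /pres_eval !big_cons !big_nil mulg1 /=; apply.
apply: (@PresRel _ _ [::] [:: (s, false); (s, false)] [::]).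
by exists s, s; rewrite cox_m_diag.
Qed.

Lemma word_eval_surj w : exists u, word_eval u == w.
Proof.
have [/(_ w) [u <-] _] := cox_presented C.
exists (map fst u); apply/eqP; rewrite /word_eval /pres_eval big_map.
apply: eq_bigr => -[s []] _ //=.
by apply: (mulgI (cox_gen s)); rewrite cox_genK mulgV.
Qed.

Definition word_of w : seq (cox_gens C) := xchoose (word_eval_surj w).

Lemma word_ofK w : word_eval (word_of w) = w.
Proof. exact/eqP/(xchooseP (word_eval_surj w)). Qed.

Lemma word_size_ex w :
  exists n, [exists u : n.-tuple (cox_gens C), word_eval u == w].
Proof.
exists (size (word_of w)); apply/existsP; exists (in_tuple (word_of w)).
exact/eqP/word_ofK.
Qed.

Definition ell w : nat := ex_minn (word_size_ex w).

(* Right weak order. *)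
Definition weak_le x y : Prop := ell y = (ell x + ell (x^-1 * y)%g)%N.

Definition right_descent w : set (cox_gens C) :=
  [set s | (ell (w * cox_gen s)%g).+1 = ell w].

Definition cone_type w : set C :=
  [set v | ell (w * v)%g = (ell w + ell v)%N].

Definition cone_types : set (set C) := range cone_type.

Definition cone_part (T : set C) : set C :=
  [set x | cone_type x^-1%g = T].

End CoxeterGroup.

(** ** The geometric representation *)

(* A vector is the family of its coordinates in the basis of simple roots. *)
Notation cox_space R C := {ffun cox_gens C -> R^o}.

Section Geometric.
Variables (R : realType) (C : coxeterSystem).
Local Notation V := (cox_space R C).
Implicit Types (w x y : C) (s t : cox_gens C) (v a b : V).

Definition simple_root s : V := [ffun t => (t == s)%:R].

Definition cox_form_coef s t : R :=
  if cox_m s t == 0%N then -1 else - cos (pi / (cox_m s t)%:R).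

Definition cox_form v1 v2 : R :=
  \sum_s \sum_t v1 s * v2 t * cox_form_coef s t.

Definition refl s v : V := v - (2 * cox_form v (simple_root s)) *: simple_root s.

Definition word_act (u : seq (cox_gens C)) v : V := foldr refl v u.

(* Independent of the word chosen for w: see [actE], [act1], [actM] and
   [act_gen] below, by which this is the action of the group. *)
Definition act w v : V := word_act (word_of w) v.

Lemma cox_form_simple v t : cox_form v (simple_root t) =
  \sum_s v s * cox_form_coef s t.
Proof.
apply: eq_bigr => s _; rewrite (bigD1 t) //= ffunE eqxx mulr1 big1 ?addr0 //.
by move=> i /negbTE it; rewrite ffunE it mulr0 mul0r.
Qed.

Lemma cox_form_simpleB v c a t : cox_form (v - c *: a) (simple_root t) =
  cox_form v (simple_root t) - c * cox_form a (simple_root t).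
Proof.
rewrite !cox_form_simple mulr_sumr -sumrB; apply: eq_bigr => s _.
by rewrite !ffunE mulrBl -mulrA.
Qed.

Lemma cox_form_simple2 s t :
  cox_form (simple_root s) (simple_root t) = cox_form_coef s t.
Proof.
rewrite cox_form_simple (bigD1 s) //= ffunE eqxx mul1r big1 ?addr0 //.
by move=> i /negbTE it; rewrite ffunE it mul0r.
Qed.

Lemma cox_form_coefC s t : cox_form_coef s t = cox_form_coef t s.
Proof. by rewrite /cox_form_coef cox_m_sym. Qed.

Lemma cox_form_coef_diag s : cox_form_coef s s = 1.
Proof. by rewrite /cox_form_coef cox_m_diag /= divr1 cospi opprK. Qed.

Lemma reflK s : involutive (refl s).
Proof.
move=> v; rewrite {1}/refl {2}/refl cox_form_simpleB cox_form_simple2.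
rewrite cox_form_coef_diag; apply/ffunP => t; rewrite !ffunE /GRing.scale /=.
by ring.
Qed.

(* With th = pi / m(s, t), the k-th power of the product of the two
   reflections is given by the sines of the multiples of th. *)
Lemma refl_braid s t v :
  word_act (flatten (nseq (cox_m s t) [:: s; t])) v = v.
Proof.
have [->|/eqP] := eqVneq (cox_m s t) 0%N; first by [].
have [->|st m0] := eqVneq s t.
  by rewrite cox_m_diag /word_act /= reflK.
have m2 : (1 < cox_m s t)%N.
  by have := cox_m_offdiag st; case: (cox_m s t) m0 => [|[|]].
set m := cox_m s t in m0 m2 *.
pose th : R := pi / m%:R.
have mth : m%:R * th = pi by rewrite mulrCA divff ?mulr1 // pnatr_eq0 -lt0n ltnW.
have sth : sin th != 0.
  rewrite gt_eqF // sin_gt0_pi // divr_gt0 ?pi_gt0 ?ltr0n ?(ltnW m2) //=.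
  by rewrite ltr_pdivrMr ?ltr0n ?(ltnW m2) // ltr_pMr ?pi_gt0 // ltr1n.
pose a := simple_root s; pose b := simple_root t.
have Bst : cox_form_coef s t = - cos th.
  by rewrite /cox_form_coef -/m; case: eqP m0.
have Bts : cox_form_coef t s = - cos th by rewrite cox_form_coefC.
pose p := cox_form v a; pose q := cox_form v b.
(* coordinates of the component of v in the plane of a and b *)
pose x := (p + cos th * q) / sin th ^+ 2.
pose y := (q + cos th * p) / sin th ^+ 2.
pose U (j : R) := (sin (j * th) * x - sin ((j - 1) * th) * y) / sin th.
have cs : sin th ^+ 2 = 1 - cos th ^+ 2 by rewrite -sin2cos2.
have c1 : 1 - cos th ^+ 2 != 0 by rewrite -cs sqrf_eq0.
have px : p = x - cos th * y by rewrite /x /y cs; field.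
have qy : q = y - cos th * x by rewrite /x /y cs; field.
have U0 : U 0 = y by rewrite /U mul0r sin0 sub0r mulN1r sinN; field.
have U1 : U 1 = x by rewrite /U subrr mul0r sin0 !mul1r; field.
have sinR j : sin ((j + 1) * th) = 2 * cos th * sin (j * th) - sin ((j - 1) * th).
  by rewrite !mulrDl mulN1r mul1r sinD sinB; ring.
have UD j : U (j + 1) = 2 * cos th * U j - U (j - 1).
  have := sinR (j - 1); rewrite subrK /U addrK sinR => ->.
  by field.
have main k : word_act (flatten (nseq k [:: s; t])) v =
    v + (U (k%:R * 2 + 1) - x) *: a + (U (k%:R * 2) - y) *: b.
  elim: k => [|k IHk]; first by rewrite mul0r add0r U0 U1 !subrr !scale0r !addr0.
  have -> : word_act (flatten (nseq k.+1 [:: s; t])) v =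
    refl s (refl t (word_act (flatten (nseq k [:: s; t])) v)) by [].
  have -> : k.+1%:R * 2 = k%:R * 2 + 1 + 1 :> R by rewrite -natr1; ring.
  rewrite {}IHk (UD (k%:R * 2 + 1 + 1)) (UD (k%:R * 2 + 1)) !addrK.
  set c := U _; set d := U _; set z := (X in refl t X).
  have z1 : z = v - (x - c) *: a - (y - d) *: b.
    by rewrite /z -!scaleNr !opprB.
  have zt : cox_form z b = q + cos th * (x - c) - (y - d).
    rewrite z1 !cox_form_simpleB -/q !cox_form_simple2 Bst cox_form_coef_diag.
    by ring.
  have zs : cox_form z a = p - (x - c) + cos th * (y - d).
    rewrite z1 !cox_form_simpleB -/p !cox_form_simple2 Bts cox_form_coef_diag.
    by ring.
  rewrite {1}/refl {1 2}/refl -/a -/b cox_form_simpleB zt zs cox_form_simple2 Bts.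
  rewrite z1 px qy; apply/ffunP => r; rewrite !ffunE /GRing.scale /=; ring.
have sin2m : sin (m%:R * 2 * th) = 0.
  by rewrite mulrAC mth mulr_natr sin2pi.
have cos2m : cos (m%:R * 2 * th) = 1.
  by rewrite mulrAC mth mulr_natr cos2pi.
have UE : (U (m%:R * 2 + 1) = x) * (U (m%:R * 2) = y).
  split; rewrite /U ?addrK !mulrDl ?mulN1r ?mul1r ?sinD ?sinB sin2m cos2m.
    by field.
  by rewrite sinN; field.
by rewrite main !UE !subrr !scale0r !addr0.
Qed.

Lemma word_act_cat u1 u2 v : word_act (u1 ++ u2) v = word_act u1 (word_act u2 v).
Proof. exact: foldr_cat. Qed.

Lemma word_act_cong u1 u2 : pres_cong (coxeter_relator (@cox_m C)) u1 u2 ->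
  word_act (map fst u1) =1 word_act (map fst u2).
Proof.
elim=> {u1 u2} [u v|u1 u2 _ IH v|u1 u2 u3 _ IH1 _ IH2 v|u s b u' v|u r u' rel_r v].
- by [].
- by rewrite IH.
- by rewrite IH1.
- by rewrite !map_cat !word_act_cat /= reflK.
- case: rel_r => s [t ->]; rewrite !map_cat !word_act_cat map_flatten map_nseq.
  by rewrite refl_braid.
Qed.

Lemma word_act_eval (u1 u2 : seq (cox_gens C)) :
  word_eval u1 = word_eval u2 -> word_act u1 =1 word_act u2.
Proof.
have [_ pres] := cox_presented C => eq12.
have fstK (u : seq (cox_gens C)) : map fst [seq (s, false) | s <- u] = u.
  by rewrite -map_comp map_id.
rewrite -[u1]fstK -[u2]fstK; apply: word_act_cong; apply/pres.
by rewrite /pres_eval !big_map.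
Qed.

Lemma actE (u : seq (cox_gens C)) v : act (word_eval u) v = word_act u v.
Proof. by apply: word_act_eval; rewrite word_ofK. Qed.

Lemma act1 v : act 1%g v = v.
Proof.
have -> : 1%g = word_eval [::] :> C by rewrite /word_eval big_nil.
exact: actE.
Qed.

Lemma actM x y v : act (x * y)%g v = act x (act y v).
Proof.
rewrite -{1}[x]word_ofK -{1}[y]word_ofK /act -word_act_cat.
by apply: word_act_eval; rewrite word_ofK /word_eval big_cat.
Qed.

Lemma act_gen s v : act (cox_gen s) v = refl s v.
Proof.
have -> : cox_gen s = word_eval [:: s] by rewrite /word_eval big_seq1.
exact: actE.
Qed.

Definition root_system : set V := [set a | exists w s, a = act w (simple_root s)].

Definition pos_roots : set V :=
  [set a | root_system a /\ forall s, 0 <= a s].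

Definition neg_roots : set V :=
  [set a | root_system a /\ forall s, a s <= 0].

Definition inversions w : set V :=
  [set a | pos_roots a /\ neg_roots (act w^-1%g a)].

Definition right_descent_roots w : set V :=
  [set - act w (simple_root s) | s in right_descent w].

(* With x in place of x^-1, this is the set written dT(x^-1)_beta. *)
Definition boundary_witness x b : set C :=
  [set y | inversions x `&` inversions y = [set b]].

(* The existence of y does not depend on the choice of x in [cone_part T], which
   is nonempty when T is a cone type. *)
Definition cone_boundary (T : set C) : set V :=
  [set b | pos_roots b /\
    exists2 x, cone_part T x & exists y, boundary_witness x b y].

Definition cone_boundary_at (T : set C) b : set C :=
  \bigcap_(x in cone_part T) boundary_witness x b.

End Geometric.

Definition min_length_in (C : coxeterSystem) (A : set C) (y : C) : Prop :=
  A y /\ forall z, A z -> (ell y <= ell z)%N.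

(* Main.v *)
(* Let y be a minimal length element with Phi(x) :&: Phi(y) = {b}. Deleting a
   right descent of y deletes one root from Phi(y), so minimality forces the only
   right-descent root to be b. Writing y = y' s, the cone type T contains y' but
   not y, which transfers Phi(x') :&: Phi(y) = {b} to every x' in Q(T).
   For the weak order, if y and z both satisfy the condition for x, then b lies in
   the inversion set of the meet of y and z. This is proved by induction on the
   depth of b: choose a simple root a_t with <b, a_t> > 0. Since b is a positive
   combination of s_t b and a_t and inversion sets are coclosed, a_t is in exactly
   one of Phi(x), Phi(y), and the same for z, so that (t x, t y, t z, s_t b) is an
   instance of smaller depth, and the meet of t y and t z yields a lower bound of
   y and z. *)
Require Import Defs.
From mathcomp Require Import all_boot all_order all_algebra.
From mathcomp Require Import ring zify.
From mathcomp Require Import boolp classical_sets reals trigo.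

Set Implicit Arguments.
Unset Strict Implicit.
Unset Printing Implicit Defensive.

Import Order.TTheory GRing.Theory Num.Theory.

Local Open Scope classical_set_scope.
Local Open Scope ring_scope.

(** * Word length: parity, descents and induction along reduced words *)

Section Length.
Variable C : coxeterSystem.
Implicit Types (w x y v : C) (s t : cox_gens C).

Lemma word_eval_cat (u1 u2 : seq (cox_gens C)) :
  word_eval (u1 ++ u2) = (word_eval u1 * word_eval u2)%g.
Proof. by rewrite /word_eval big_cat. Qed.

Lemma word_eval1 s : word_eval [:: s] = cox_gen s.
Proof. by rewrite /word_eval big_seq1. Qed.

Lemma cox_genV s : ((cox_gen s)^-1 = cox_gen s)%g.
Proof. by apply: (mulgI (cox_gen s)); rewrite cox_genK mulgV. Qed.

Lemma mul_genK w s : (w * cox_gen s * cox_gen s = w)%g.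
Proof. by rewrite -mulgA cox_genK mulg1. Qed.

Lemma gen_mulK w s : (cox_gen s * (cox_gen s * w) = w)%g.
Proof. by rewrite mulgA cox_genK mul1g. Qed.

Lemma word_eval_rev (u : seq (cox_gens C)) :
  (word_eval (rev u) = (word_eval u)^-1)%g.
Proof.
elim: u => [|s u IH]; first by rewrite /word_eval !big_nil invg1.
by rewrite rev_cons -cats1 word_eval_cat IH word_eval1 -cat1s word_eval_cat
  word_eval1 invgM cox_genV.
Qed.

Lemma ell_word_eval (u : seq (cox_gens C)) : (ell (word_eval u) <= size u)%N.
Proof.
rewrite /ell; case: ex_minnP => n _; apply.
by apply/existsP; exists (in_tuple u).
Qed.

Lemma reduced_word w : exists2 u, word_eval u = w & size u = ell w.
Proof.
rewrite /ell; case: ex_minnP => n /existsP[u /eqP uw] _.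
by exists u; rewrite ?size_tuple.
Qed.

(** Cancellation removes two letters and the relator of $(s,t)$ has $2m(s,t)$ letters, so each
    generating step of the congruence preserves parity. *)
Lemma odd_size_word_eval (u1 u2 : seq (cox_gens C)) :
  word_eval u1 = word_eval u2 -> odd (size u1) = odd (size u2).
Proof.
have cong l1 l2 : pres_cong (coxeter_relator (@cox_m C)) l1 l2 ->
    odd (size l1) = odd (size l2).
  elim=> {l1 l2} [//|//|l1 l2 l3 _ -> _ //|l1 s b l2|l1 r l2 [s [t ->]]].
    by rewrite !size_cat /= !oddD /=.
  have even k : odd (size (flatten (nseq k [:: (s, false); (t, false)]))) = false.
    by elim: k => //= k ->.
  by rewrite !size_cat !oddD even.
have [_ pres] := cox_presented C => eq12.
rewrite -(size_map (pair^~ false) u1) -(size_map (pair^~ false) u2).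
by apply/cong/pres; rewrite /pres_eval !big_map.
Qed.

Lemma ell1 : ell (1 : C)%g = 0%N.
Proof.
by apply/eqP; rewrite -leqn0; have := ell_word_eval [::]; rewrite /word_eval big_nil.
Qed.

Lemma ell_eq0 w : ell w = 0%N -> w = 1%g.
Proof.
have [u <- <-] := reduced_word w.
by move/size0nil => ->; rewrite /word_eval big_nil.
Qed.

Lemma ell_mul_le w x : (ell (w * x)%g <= ell w + ell x)%N.
Proof.
have [u <- <-] := reduced_word w; have [v <- <-] := reduced_word x.
by rewrite -word_eval_cat -size_cat ell_word_eval.
Qed.

Lemma ell_inv w : ell (w^-1)%g = ell w.
Proof.
have le x : (ell (x^-1)%g <= ell x)%N.
  have [u <- <-] := reduced_word x.
  by rewrite -word_eval_rev -size_rev ell_word_eval.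
by apply/eqP; rewrite eqn_leq le -{1}[w]invgK le.
Qed.

Lemma ell_gen_le s : (ell (cox_gen s) <= 1)%N.
Proof. by rewrite -word_eval1 ell_word_eval. Qed.

Lemma odd_ell_gen w s : odd (ell (w * cox_gen s)%g) = ~~ odd (ell w).
Proof.
have [u uw <-] := reduced_word w; have [v vw <-] := reduced_word (w * cox_gen s)%g.
have /odd_size_word_eval -> : word_eval v = word_eval (u ++ [:: s]).
  by rewrite vw word_eval_cat uw word_eval1.
by rewrite size_cat oddD addbT.
Qed.

(** The two lengths differ by at most one, and parity rules out equality. *)
Lemma ell_gen w s :
  (ell (w * cox_gen s)%g = (ell w).+1) \/ (ell w = (ell (w * cox_gen s)%g).+1).
Proof.
have := odd_ell_gen w s; have := ell_mul_le w (cox_gen s).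
have := ell_mul_le (w * cox_gen s)%g (cox_gen s); rewrite mul_genK.
have := ell_gen_le s; lia.
Qed.

Lemma ell_gt0_descent w : (0 < ell w)%N ->
  exists s, ell w = (ell (w * cox_gen s)%g).+1.
Proof.
have [u uw su] := reduced_word w; rewrite -su; case/lastP: u uw su => // u s.
rewrite -cats1 word_eval_cat word_eval1 size_cat addn1 => <- su _; exists s.
rewrite mul_genK; have := ell_word_eval u.
have := ell_gen (word_eval u * cox_gen s)%g s; rewrite mul_genK; lia.
Qed.

Lemma ell_ind (P : C -> Prop) : P 1%g ->
  (forall w s, ell (w * cox_gen s)%g = (ell w).+1 -> P w -> P (w * cox_gen s)%g) ->
  forall w, P w.
Proof.
move=> P1 PS w; have [n] := ubnP (ell w); elim: n w => // n IH w le_wn.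
have [/ell_eq0 -> //|/ell_gt0_descent[s es]] := posnP (ell w).
rewrite -(mul_genK w s); apply: PS; first by rewrite mul_genK.
by apply: IH; lia.
Qed.

End Length.

(** * Alternating words in two generators and the braid relation *)

Section Alternating.
Variable C : coxeterSystem.
Implicit Types (s t : cox_gens C).

(* The product of k alternating factors s and t, the last one being t. *)
Fixpoint alt s t (k : nat) : C :=
  if k is k'.+1 then (cox_gen (if odd k' then s else t) * alt s t k')%g else 1%g.

Lemma alt_rcons s t k : alt t s k.+1 = (alt s t k * cox_gen s)%g.
Proof.
elim: k => [|k IH]; first by rewrite /= mulg1 mul1g.
transitivity (cox_gen (if odd k.+1 then t else s) * alt t s k.+1)%g => //.
by rewrite IH /= mulgA; case: (odd k).
Qed.

Lemma ell_alt s t k : (ell (alt s t k) <= k)%N.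
Proof.
elim: k => [|k IH] /=; first by rewrite ell1.
set r := if odd k then s else t; have := ell_mul_le (cox_gen r) (alt s t k).
have := ell_gen_le r; lia.
Qed.

Lemma alt_suffix s t m k : (m <= k)%N ->
  exists2 p, alt s t k = (p * alt s t m)%g & (ell p <= k - m)%N.
Proof.
elim: k => [|k IH]; first by rewrite leqn0 => /eqP ->; exists 1%g; rewrite ?mul1g ?ell1.
rewrite leq_eqVlt => /orP[/eqP -> | lt_mk].
  by exists 1%g; rewrite ?mul1g ?ell1.
have [p pE lp] := IH lt_mk; set g := cox_gen (if odd k then s else t).
exists (g * p)%g; first by rewrite -mulgA -pE.
have := ell_mul_le g p; have := ell_gen_le (if odd k then s else t).
rewrite -/g; lia.
Qed.

(** Inversion reverses the first word; since j and k have the same parity, the letters meeting at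
    the junction differ and the product still alternates. *)
Lemma altV_mul s t j k : ~~ odd (j + k) ->
  ((alt t s j)^-1 * alt s t k = alt s t (j + k))%g.
Proof.
elim: j k => [|j IH] k; first by rewrite invg1 mul1g.
rewrite addSnnS => ojk; rewrite -IH // /= invgM cox_genV -mulgA.
by move: ojk; rewrite oddD /=; case: (odd j); case: (odd k).
Qed.

(** The relator $(st)^m$ is the alternating word of length 2m, which [altV_mul] splits into two
    halves. For infinite m(s, t), encoded as 0, both sides are 1. *)
Lemma alt_braid s t : alt s t (cox_m s t) = alt t s (cox_m s t).
Proof.
set m := cox_m s t; suff E : alt s t (m + m) = 1%g.
  by apply: (mulgI (alt t s m)^-1%g); rewrite altV_mul ?mulVg // addnn odd_double.
have pw k : alt s t (k + k) = word_eval (flatten (nseq k [:: s; t])).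
  elim: k => [|k IH]; first by rewrite /word_eval big_nil.
  rewrite addnS addSn /= !addnn odd_double /= -addnn IH.
  by rewrite /word_eval !big_cons.
rewrite pw; set l := flatten _; have [_ pres] := cox_presented C.
have [_] := pres [seq (r, false) | r <- l] [::]; rewrite /pres_eval big_map big_nil; apply.
rewrite /l map_flatten map_nseq.
set r := flatten _; rewrite -[r]cats0 -[r ++ [::]]cat0s.
by apply: PresRel; exists s, t.
Qed.

End Alternating.

(** * Linearity of the action and positivity of $w\alpha_s$ when $\ell(ws)>\ell(w)$ *)

Section Action.
Variables (R : realType) (C : coxeterSystem).
Local Notation V := (cox_space R C).
Local Notation a_ := (simple_root R).
Implicit Types (w x y : C) (s t r : cox_gens C) (u v a b : V).

Lemma cox_form_linear c u v s :
  cox_form (c *: u + v) (a_ s) = c * cox_form u (a_ s) + cox_form v (a_ s).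
Proof.
rewrite !cox_form_simple mulr_sumr -big_split; apply: eq_bigr => r _.
by rewrite !ffunE mulrDl -mulrA.
Qed.

Lemma refl_linear c u v s : refl s (c *: u + v) = c *: refl s u + refl s v.
Proof.
apply/ffunP => r; rewrite /refl cox_form_linear !ffunE /GRing.scale /=; ring.
Qed.

Lemma act_linear c u v w : act w (c *: u + v) = c *: act w u + act w v.
Proof.
have [l <- _] := reduced_word w; rewrite !actE.
by elim: l => //= s l ->; rewrite refl_linear.
Qed.

Lemma act0 w : act w 0 = 0 :> V.
Proof. by apply: (addrI (act w 0)); have := act_linear 1 0 0 w; rewrite !scale1r !addr0. Qed.

Lemma actD u v w : act w (u + v) = act w u + act w v.
Proof. by have := act_linear 1 u v w; rewrite !scale1r. Qed.

Lemma actZ c u w : act w (c *: u) = c *: act w u.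
Proof. by have := act_linear c u 0 w; rewrite act0 !addr0. Qed.

Lemma actN u w : act w (- u) = - act w u.
Proof. by rewrite -scaleN1r actZ scaleN1r. Qed.

Lemma actB u v w : act w (u - v) = act w u - act w v.
Proof. by rewrite actD actN. Qed.

Lemma actK w : cancel (act w) (@act R C w^-1%g).
Proof. by move=> v; rewrite -actM mulVg act1. Qed.

Lemma actVK w : cancel (@act R C w^-1%g) (act w).
Proof. by move=> v; rewrite -actM mulgV act1. Qed.

Lemma act_simple_root_sum w v : act w v = \sum_s v s *: act w (a_ s).
Proof.
have {1}-> : v = \sum_s v s *: a_ s.
  apply/ffunP => r; rewrite sum_ffunE (bigD1 r) //= !ffunE eqxx big1 ?addr0.
    by rewrite /GRing.scale /= mulr1.
  by move=> i /negbTE ir; rewrite !ffunE eq_sym ir /GRing.scale /= mulr0.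
by elim/big_ind2: _ => [|x1 x2 y1 y2 <- <-|s _]; rewrite ?act0 ?actD ?actZ.
Qed.

Definition nonneg v := forall s, 0 <= v s.

Lemma act_nonneg w v : nonneg v ->
  (forall s, v s != 0 -> nonneg (act w (a_ s))) -> nonneg (act w v).
Proof.
move=> v0 wv r; rewrite act_simple_root_sum sum_ffunE; apply: sumr_ge0 => s _.
rewrite !ffunE; have [->|/wv/(_ r) ws] := eqVneq (v s) 0; first by rewrite scale0r.
by rewrite mulr_ge0.
Qed.

Lemma refl_simple s t : refl s (a_ t) = a_ t - (2 * cox_form_coef R t s) *: a_ s.
Proof. by rewrite /refl cox_form_simple2. Qed.

Lemma simple_rootE s t : a_ s t = (t == s)%:R.
Proof. by rewrite ffunE. Qed.

(* Chebyshev polynomials of the second kind: cheb (cos th) k = sin (k th) / sin th. *)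
Fixpoint cheb (c : R) (k : nat) : R :=
  if k is k1.+1 then
    if k1 is k2.+1 then 2 * c * cheb c k1 - cheb c k2 else 1
  else 0.

Lemma chebSS c k : cheb c k.+2 = 2 * c * cheb c k.+1 - cheb c k.
Proof. by []. Qed.

(** The reflection in $\alpha_s$ sends $p\alpha_s+q\alpha_t$ to $(2cq-p)\alpha_s+q\alpha_t$, which
    is the recurrence of [cheb]. *)
Lemma act_alt s t k : let c := - cox_form_coef R s t in
  act (alt s t k) (a_ s) =
  if odd k then cheb c k *: a_ s + cheb c k.+1 *: a_ t
  else cheb c k.+1 *: a_ s + cheb c k *: a_ t.
Proof.
move=> c; elim: k => [|k IH]; first by rewrite act1 /= scale1r scale0r addr0.
have -> : alt s t k.+1 = (cox_gen (if odd k then s else t) * alt s t k)%g by [].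
rewrite actM IH act_gen chebSS [odd k.+1]/=.
have ss r : refl r (a_ r) = a_ r - (2 : R) *: a_ r.
  by rewrite refl_simple cox_form_coef_diag mulr1.
have st : refl s (a_ t) = a_ t + (2 * c) *: a_ s.
  by rewrite refl_simple cox_form_coefC mulrN scaleNr.
have ts : refl t (a_ s) = a_ s + (2 * c) *: a_ t.
  by rewrite refl_simple mulrN scaleNr.
have reflZ d r v : refl r (d *: v) = d *: refl r v.
  by rewrite -!act_gen actZ.
by case: ifP => _; rewrite /= refl_linear reflZ ss ?st ?ts; apply/ffunP => r;
  rewrite !ffunE /GRing.scale /=; ring.
Qed.

(** For finite m the sign is that of sin (k th) with th = pi / m and k th in [0, pi]. For infinite m
    the argument of [cheb] is 1 and the value is k. *)
Lemma cheb_ge0 s t k : s != t -> (cox_m s t == 0)%N || (k <= cox_m s t)%N ->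
  0 <= cheb (- cox_form_coef R s t) k.
Proof.
move=> st; rewrite /cox_form_coef; case: eqP => [_ _|/eqP m0 /= km]; rewrite opprK.
  suff [-> //] : cheb 1 k = k%:R /\ cheb 1 k.+1 = k.+1%:R.
  elim: k => [//|k [IH1 IH2]]; split=> //.
  by rewrite chebSS IH1 IH2 -!natr1; ring.
have m2 : (1 < cox_m s t)%N.
  by have := cox_m_offdiag st; case: (cox_m s t) m0 => [|[|]].
set m := cox_m s t in m0 m2 km *; set th := pi / m%:R.
have m_gt0 : 0 < m%:R :> R by rewrite ltr0n ltnW.
have sth : 0 < sin th.
  apply: sin_gt0_pi; rewrite ?divr_gt0 ?pi_gt0 //=.
  by rewrite ltr_pdivrMr // ltr_pMr ?pi_gt0 // ltr1n.
have [E _] : sin th * cheb (cos th) k = sin (k%:R * th) /\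
    sin th * cheb (cos th) k.+1 = sin (k.+1%:R * th).
  elim: {km} k => [|k [IH1 IH2]]; first by rewrite mul0r sin0 mul1r mulr0 mulr1.
  split=> //; rewrite chebSS mulrBr IH1 mulrCA IH2.
  have -> : k.+2%:R * th = k.+1%:R * th + th by rewrite -natr1; ring.
  have -> : k%:R * th = k.+1%:R * th - th by rewrite -(natr1 k); ring.
  by rewrite sinB sinD; ring.
rewrite -(pmulr_rge0 _ sth) E; apply: sin_ge0_pi.
have th0 : 0 <= th by rewrite divr_ge0 ?pi_ge0 ?ler0n.
apply/andP; split; first by rewrite mulr_ge0 ?ler0n.
by rewrite /th mulrCA ler_piMr ?pi_ge0 // ler_pdivrMr // mul1r ler_nat.
Qed.

(* Write w = v (... s t) with an alternating factor of maximal length k; the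
   coefficients of the image of the simple root of s under that factor are
   nonnegative because k < m(s, t). *)
Lemma act_simple_root_ge0 w s : ell (w * cox_gen s)%g = (ell w).+1 ->
  nonneg (act w (a_ s)).
Proof.
have [n] := ubnP (ell w); elim: n w s => // n IH w s lt_wn ws.
have [/ell_eq0 ->|/ell_gt0_descent[t wt]] := posnP (ell w).
  by rewrite act1 => r; rewrite simple_rootE ler0n.
have st : s != t by apply: contra_eq_neq wt => <-; rewrite ws; lia.
(* Inner induction on the length of [v]: letters s and t move from the end of [v] into the
   alternating factor until neither is a right descent of [v]. *)
have key k (v : C) : w = (v * alt s t k.+1)%g -> ell w = (ell v + k.+1)%N ->
    nonneg (act w (a_ s)).
  have [j] := ubnP (ell v); elim: j k v => // j IHj k v lt_vj wE lw.
  pose p := if odd k.+1 then s else t; pose q := if odd k then s else t.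
  have vq : ell (v * cox_gen q)%g = (ell v).+1.
    have := ell_gen v q; have := ell_mul_le (v * cox_gen q)%g (alt s t k).
    by rewrite -mulgA -/(alt s t k.+1) -wE; have := ell_alt s t k; lia.
  have [vp|vp] := ell_gen v p; last first.
    apply: (IHj k.+1 (v * cox_gen p)%g); [lia| |lia].
    have -> : alt s t k.+2 = (cox_gen p * alt s t k.+1)%g by [].
    by rewrite mulgA mul_genK.
  have vst r : (r == s) || (r == t) -> ell (v * cox_gen r)%g = (ell v).+1.
    by move: vp vq; rewrite /p /q /=; case: (odd k) => ? ? /orP[] /eqP ->.
  (* If the factor had m(s, t) or more letters, the braid relation would make s its last letter, and
     [w * cox_gen s] would be shorter than [w]. *)
  have km : (cox_m s t == 0)%N || (k.+2 <= cox_m s t)%N.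
    have [//|m0] := eqVneq (cox_m s t) 0%N; rewrite /= ltnNge; apply/negP => mk.
    have [g gE lg] := alt_suffix s t mk; have := ell_alt s t (cox_m s t).-1.
    have ws' : (w * cox_gen s = v * (g * alt s t (cox_m s t).-1))%g.
      rewrite wE gE alt_braid -{1}(prednK (n := cox_m s t)) ?lt0n // alt_rcons.
      by rewrite -!mulgA cox_genK mulg1.
    have := ell_mul_le v (g * alt s t (cox_m s t).-1)%g.
    have := ell_mul_le g (alt s t (cox_m s t).-1).
    rewrite -ws' ws; move: m0; rewrite -lt0n; lia.
  rewrite wE actM act_alt; apply: act_nonneg => r.
    have [c1 c2] : 0 <= cheb (- cox_form_coef R s t) k.+1 /\
        0 <= cheb (- cox_form_coef R s t) k.+2.
      by split; apply: cheb_ge0 => //; case/orP: km => [->//|/ltnW ->]; rewrite orbT.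
    by case: ifP => _; rewrite 2!ffunE /GRing.scale /= !ffunE addr_ge0 // mulr_ge0 ?ler0n.
  have [rst _|] := boolP ((r == s) || (r == t)).
    by apply: IH; [lia|exact: vst].
  rewrite negb_or => /andP[/negbTE rs /negbTE rt].
  by case: ifP => _; rewrite !ffunE rs rt !scaler0 addr0 eqxx.
by apply: (key 0%N (w * cox_gen t)%g); rewrite /= ?mulg1 ?mul_genK //; lia.
Qed.
End Action.

(** * Roots, inversion sets and their relation to length *)

Section Inversions.
Variables (R : realType) (C : coxeterSystem).
Local Notation V := (cox_space R C).
Local Notation a_ := (simple_root R).
Local Notation Phi := (@inversions R C).
Local Notation root := (@root_system R C).
Implicit Types (w x y : C) (s t r : cox_gens C) (u v a b : V).

Lemma cox_formC u v : cox_form u v = cox_form v u.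
Proof.
rewrite /cox_form exchange_big; apply: eq_bigr => s _; apply: eq_bigr => t _.
by rewrite cox_form_coefC; ring.
Qed.

Lemma cox_formBl c u v b : cox_form (u - c *: v) b = cox_form u b - c * cox_form v b.
Proof.
rewrite /cox_form mulr_sumr -sumrB; apply: eq_bigr => s _.
rewrite mulr_sumr -sumrB; apply: eq_bigr => t _.
by rewrite !ffunE /GRing.scale /=; ring.
Qed.

Lemma cox_form0 v : cox_form 0 v = 0.
Proof.
apply: big1 => s _; apply: big1 => t _.
by have -> : (0 : V) s = 0; rewrite ?mul0r // ffunE.
Qed.

Lemma cox_formZ c u v : cox_form (c *: u) v = c * cox_form u v.
Proof.
by rewrite -[c *: u]opprK -scaleNr -sub0r cox_formBl cox_form0 sub0r mulNr opprK.
Qed.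

Lemma cox_form_refl s v : cox_form (refl s v) (refl s v) = cox_form v v.
Proof.
rewrite {1}/refl cox_formBl !(cox_formC _ (refl s v)) /refl !cox_formBl.
rewrite (cox_formC (a_ s) v) cox_form_simple2 cox_form_coef_diag; ring.
Qed.

Lemma cox_form_root a : root a -> cox_form a a = 1.
Proof.
case=> w [s ->]; have [l <- _] := reduced_word w; rewrite actE.
elim: l => [|t l /=]; last by rewrite cox_form_refl.
by rewrite cox_form_simple2 cox_form_coef_diag.
Qed.

Lemma root_simple s : root (a_ s).
Proof. by exists 1%g, s; rewrite act1. Qed.

Lemma root_act w a : root a -> root (act w a).
Proof. by case=> x [s ->]; exists (w * x)%g, s; rewrite actM. Qed.

Lemma root_refl s a : root a -> root (refl s a).
Proof. by rewrite -act_gen; apply: root_act. Qed.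

Lemma refl_self s : refl s (a_ s) = - a_ s.
Proof.
rewrite refl_simple cox_form_coef_diag mulr1.
by apply/ffunP => r; rewrite !ffunE /GRing.scale /=; ring.
Qed.

Lemma root_opp a : root a -> root (- a).
Proof.
case=> w [s ->]; exists (w * cox_gen s)%g, s.
by rewrite actM act_gen refl_self actN.
Qed.

Lemma reflN s v : refl s (- v) = - refl s v.
Proof. by rewrite -!act_gen actN. Qed.

Lemma nonneg_simple s : nonneg (a_ s).
Proof. by move=> r; rewrite simple_rootE ler0n. Qed.

Lemma act_simple_root_le0 w s : ell w = (ell (w * cox_gen s)%g).+1 ->
  nonneg (- act w (a_ s)).
Proof.
move=> ws; have := @act_simple_root_ge0 R C (w * cox_gen s)%g s.
by rewrite mul_genK actM act_gen refl_self actN; apply.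
Qed.

Lemma root_sign a : root a -> nonneg a \/ nonneg (- a).
Proof.
case=> w [s ->]; have [/act_simple_root_ge0|/act_simple_root_le0] := ell_gen w s.
  by left.
by right.
Qed.

Lemma root_signF a : root a -> nonneg a -> nonneg (- a) -> False.
Proof.
move=> /cox_form_root a1 pa na; suff a0 : a = 0.
  by move/eqP: a1; rewrite a0 cox_form0 eq_sym oner_eq0.
apply/ffunP => s; rewrite ffunE; apply/eqP; rewrite eq_le pa andbT.
by have := na s; rewrite ffunE oppr_ge0.
Qed.

Lemma ell_gen_gt w s : nonneg (act w (a_ s)) -> ell (w * cox_gen s)%g = (ell w).+1.
Proof.
move=> ws; have [//|/act_simple_root_le0] := ell_gen w s.
by case/(root_signF (root_act w (root_simple s)) ws).
Qed.

Lemma ell_gen_lt w s : nonneg (- act w (a_ s)) -> ell w = (ell (w * cox_gen s)%g).+1.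
Proof.
move=> ws; have [/act_simple_root_ge0|//] := ell_gen w s.
by move=> /(_ R) pw; case: (root_signF (root_act w (root_simple s)) pw ws).
Qed.

Lemma reflE s v r : r != s -> refl s v r = v r.
Proof. by move=> /negbTE rs; rewrite !ffunE rs scaler0 subr0. Qed.

Lemma root_simple_eq s a : root a -> nonneg a -> (forall r, r != s -> a r = 0) ->
  a = a_ s.
Proof.
move=> ra pa a0; have aE : a = a s *: a_ s.
  apply/ffunP => r; rewrite !ffunE; have [->|/a0 ->] := eqVneq r s.
    by rewrite /GRing.scale /= mulr1.
  by rewrite scaler0.
have : a s ^+ 2 == 1.
  rewrite -(cox_form_root ra) aE cox_formZ cox_formC cox_formZ cox_form_simple2.
  by rewrite cox_form_coef_diag mulr1 ffunE simple_rootE eqxx /GRing.scale /= mulr1 expr2.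
rewrite sqrp_eq1 // => /eqP as1.
by rewrite aE as1 scale1r.
Qed.

(** The reflection changes only the coordinate at s, so a negative image forces all other
    coordinates of [a] to vanish. *)
Lemma refl_nonneg s a : root a -> nonneg a -> a <> a_ s -> nonneg (refl s a).
Proof.
move=> ra pa nas; have [//|nr] := root_sign (root_refl s ra).
case: nas; apply: root_simple_eq => // r rs; apply/eqP.
by rewrite eq_le pa andbT; have := nr r; rewrite ffunE reflE // oppr_ge0.
Qed.

Lemma inversionsE w a :
  Phi w a <-> [/\ root a, nonneg a & nonneg (- act w^-1 a)].
Proof.
split=> [[[ra pa] [_ na]]|[ra pa na]].
  by split=> // s; rewrite ffunE oppr_ge0.
split=> //; split; first exact: root_act.
by move=> s; have := na s; rewrite ffunE oppr_ge0.
Qed.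

Lemma not_inversions w a : root a -> nonneg a ->
  ~ Phi w a <-> nonneg (act w^-1 a).
Proof.
move=> ra pa; split=> [nw|pw /inversionsE[_ _]]; last first.
  by apply: root_signF => //; apply: root_act.
have [//|na] := root_sign (root_act w^-1 ra).
by case: nw; apply/inversionsE.
Qed.

Lemma inversions1 a : ~ Phi 1%g a.
Proof. by case/inversionsE; rewrite invg1 act1 => ra pa; apply: root_signF. Qed.

Lemma inversions_mul_gen w s a : ell (w * cox_gen s)%g = (ell w).+1 ->
  Phi (w * cox_gen s)%g a <-> Phi w a \/ a = act w (a_ s).
Proof.
move=> /act_simple_root_ge0-/(_ R) pws; rewrite !inversionsE invgM cox_genV actM act_gen.
split=> [[ra pa na]|[[ra pa na]|->]].
- have [pb|nb] := root_sign (root_act w^-1 ra); last by left.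
  right; apply: contrapT => ne.
  apply: (root_signF (root_refl s (root_act w^-1 ra))) => //.
  apply: refl_nonneg => // [|e]; first exact: root_act.
  by apply: ne; rewrite -e actVK.
- split=> //; rewrite -reflN; apply: refl_nonneg => // [|e].
    exact/root_opp/root_act.
  by apply: (root_signF ra) => //; rewrite -[a](actVK w) -actN e.
- split=> //; first exact/root_act/root_simple.
  by rewrite actK refl_self opprK; apply: nonneg_simple.
Qed.

Lemma inversions_gen s a : Phi (cox_gen s) a <-> a = a_ s.
Proof.
rewrite -[cox_gen s]mul1g inversions_mul_gen.
  by rewrite act1; split=> [[/inversions1|]|->]; [| |right].
by apply: ell_gen_gt; rewrite act1; apply: nonneg_simple.
Qed.

Lemma inversions_gen_mul w s a : root a -> nonneg a -> a <> a_ s ->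
  Phi (cox_gen s * w)%g a <-> Phi w (refl s a).
Proof.
move=> ra pa nas; rewrite !inversionsE invgM cox_genV actM act_gen.
split=> [[_ _ na]|[_ _ na]]; split=> //; first exact: root_refl.
exact: refl_nonneg.
Qed.

Lemma inversions_gen_mul_self w s : Phi (cox_gen s * w)%g (a_ s) <-> ~ Phi w (a_ s).
Proof.
rewrite not_inversions; [|exact: root_simple|exact: nonneg_simple].
rewrite inversionsE invgM cox_genV actM act_gen refl_self actN opprK.
by split=> [[]//|pw]; split=> //; [exact: root_simple|exact: nonneg_simple].
Qed.

(** Along a reduced word of y, appending s adds the root $y\alpha_s$ to $\Phi(y)$; the length of the
    product grows exactly when $xy\alpha_s$ is positive, that is, when
    $y\alpha_s\notin\Phi(x^{-1})$. *)
Lemma ell_mul_inversions x y :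
  ell (x * y)%g = (ell x + ell y)%N <-> forall a, ~ (Phi x^-1 a /\ Phi y a).
Proof.
elim/ell_ind: y => [|y s ys IH].
  by rewrite mulg1 ell1 addn0; split=> // _ a [_ /inversions1].
have wE : ell (x * (y * cox_gen s))%g = (ell x + ell (y * cox_gen s))%N <->
    ell (x * y)%g = (ell x + ell y)%N /\ nonneg (act x (act y (a_ s))).
  have -> : (x * (y * cox_gen s) = x * y * cox_gen s)%g by rewrite mulgA.
  rewrite -actM; split=> [e|[e /ell_gen_gt]]; last by lia.
  have e2 : ell (x * y * cox_gen s)%g = (ell (x * y)).+1.
    by have := ell_gen (x * y)%g s; have := ell_mul_le x y; lia.
  by split; [lia|exact: act_simple_root_ge0].
rewrite wE IH; have p0 := @act_simple_root_ge0 R C y s ys.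
have r0 : root (act y (a_ s)) by apply/root_act/root_simple.
have := not_inversions x^-1 r0 p0; rewrite invgK => <-.
split=> [[h1 h2] a|h].
  by rewrite inversions_mul_gen // => -[xa [ya|aE]]; [case: (h1 a)|case: h2; rewrite -aE].
split=> [a [xa ya]|xa]; [apply: (h a)|apply: (h (act y (a_ s)))]; split=> //.
  by apply/inversions_mul_gen => //; left.
by apply/inversions_mul_gen => //; right.
Qed.

(** By [ell_mul_inversions] the left side says that $\Phi(x^{-1})$ and $\Phi(x^{-1}y)$ are disjoint,
    and $a\mapsto -x^{-1}a$ carries $\Phi(x)$ onto $\Phi(x^{-1})$. *)
Lemma weak_leE x y : weak_le x y <-> Phi x `<=` Phi y.
Proof.
have := ell_mul_inversions x (x^-1 * y)%g.
have -> : (x * (x^-1 * y) = y)%g by rewrite mulgA mulgV mul1g.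
rewrite -/(weak_le x y) => ->.
split=> h a.
  move=> /inversionsE[ra pa na]; apply/inversionsE; split=> //.
  have xa : Phi x^-1 (- act x^-1 a).
    apply/inversionsE; split=> //; first exact/root_opp/root_act.
    by rewrite invgK actN actVK opprK.
  have : ~ Phi (x^-1 * y)%g (- act x^-1 a) by move=> ?; apply: (h (- act x^-1 a)).
  rewrite not_inversions //; last exact/root_opp/root_act.
  by rewrite invgM invgK actM actN actVK actN.
case=> /inversionsE[ra pa]; rewrite invgK => na /inversionsE[_ _].
rewrite invgM invgK actM => nb.
have /h/inversionsE[_ _ nc] : Phi x (- act x a).
  apply/inversionsE; split=> //; first exact/root_opp/root_act.
  by rewrite actN actK opprK.
apply: (root_signF (root_act (y^-1)%g (root_act x ra))) => //.
by move: nc; rewrite actN opprK.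
Qed.
End Inversions.

(** * Meets in the weak order and induction on the depth of a root *)

Section WeakOrder.
Variables (R : realType) (C : coxeterSystem).
Local Notation V := (cox_space R C).
Local Notation a_ := (simple_root R).
Local Notation Phi := (@inversions R C).
Local Notation root := (@root_system R C).
Implicit Types (w x y z c : C) (s t r : cox_gens C) (u v a b : V).

Lemma act_nonpos w v : nonneg v ->
  (forall s, v s != 0 -> nonneg (- act w (a_ s))) -> nonneg (- act w v).
Proof.
move=> v0 wv r; rewrite act_simple_root_sum -sumrN sum_ffunE.
apply: sumr_ge0 => s _; rewrite -scalerN !ffunE.
have [->|/wv/(_ r)] := eqVneq (v s) 0; first by rewrite scale0r.
by rewrite ffunE => ws; rewrite mulr_ge0.
Qed.

Lemma inversions_simple_cone y a : root a -> nonneg a ->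
  (forall s, a s != 0 -> Phi y (a_ s)) -> Phi y a.
Proof.
move=> ra pa ya; apply/inversionsE; split=> //; apply: act_nonpos => // s.
by move/ya/inversionsE=> [].
Qed.

Lemma left_descent_ex w : w != 1%g ->
  exists2 t, Phi w (a_ t) & ell w = (ell (cox_gen t * w)%g).+1.
Proof.
move=> w1; have [|t wt] := @ell_gt0_descent _ w^-1%g.
  by rewrite ell_inv lt0n; apply: contra w1 => /eqP/ell_eq0 ->.
have e : (cox_gen t * w = (w^-1 * cox_gen t)^-1)%g by rewrite invgM invgK cox_genV.
exists t; last by rewrite e ell_inv -wt ell_inv.
apply/inversionsE; split; [exact: root_simple|exact: nonneg_simple|].
exact: act_simple_root_le0.
Qed.

Lemma left_descent_ell w t : Phi w (a_ t) -> ell w = (ell (cox_gen t * w)%g).+1.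
Proof.
move=> /inversionsE[_ _ /ell_gen_lt].
have -> : (w^-1 * cox_gen t = (cox_gen t * w)^-1)%g by rewrite invgM cox_genV.
by rewrite !ell_inv.
Qed.

(** Left multiplication by t toggles $\alpha_t$ and transports all other inversions by [refl t]; the
    disjunction settles $\alpha_t$ itself. *)
Lemma inversions_gen_mul_sub t x y : Phi x `<=` Phi (cox_gen t * y)%g ->
  Phi x (a_ t) \/ Phi y (a_ t) -> Phi (cox_gen t * x)%g `<=` Phi y.
Proof.
move=> sxy xy a xa; have [ra pa _] := (inversionsE _ _).1 xa.
have [e|ne] := pselect (a = a_ t).
  by rewrite e in xa *; case: xy => // xt; case/inversions_gen_mul_self: xa.
move/inversions_gen_mul: xa => /(_ ra pa ne) /sxy.
have r1 := root_refl t ra; have p1 := refl_nonneg ra pa ne.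
move/inversions_gen_mul => /(_ r1 p1); rewrite reflK; apply.
move/(congr1 (refl t)); rewrite reflK refl_self => aE.
by apply: (root_signF ra pa); rewrite aE opprK; apply: nonneg_simple.
Qed.

(** [c] is a maximal prefix of [y] in the subgroup generated by t and t'. Its inversions are
    nonnegative combinations of the two simple roots, so any [z] inverting both simple roots inverts
    them all. *)
Lemma dihedral_join y t t' : Phi y (a_ t) -> Phi y (a_ t') ->
  exists c, [/\ Phi c (a_ t), Phi c (a_ t') &
    forall z, Phi z (a_ t) -> Phi z (a_ t') -> Phi c `<=` Phi z].
Proof.
move=> yt yt'; pose I r := (r == t) || (r == t').
have yI r : I r -> Phi y (a_ r) by case/orP => /eqP ->.
pose supp v := forall s, ~~ I s -> v s = 0.
have supp_refl r v : I r -> supp v -> supp (refl r v).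
  by move=> Ir vI s Is; rewrite reflE ?vI //; apply: contraNneq Is => ->.
have supp_simple r : I r -> supp (a_ r).
  by move=> Ir s Is; rewrite simple_rootE; case: eqP Is => // ->; rewrite Ir.
(* Membership in the parabolic subgroup is recorded by supports: inversions lie in the plane of the
   two simple roots, which [c] and its inverse preserve. *)
pose inv c := [/\ Phi c `<=` Phi y, forall a, Phi c a -> supp a,
   forall v, supp v -> supp (act c v) & forall v, supp v -> supp (act c^-1 v)].
have [c [cy cI cs csV] cmax] : exists2 c, inv c &
    forall r, I r -> nonneg (act y^-1 (act c (a_ r))).
  have : inv 1%g.
    split=> [a /inversions1 //|a /inversions1 //|v|v]; rewrite ?invg1 act1 //.
  move: (1%g : C) => c; have [n] := ubnP (ell (c^-1 * y)%g).
  elim: n c => // n IH c lt_cn ic.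
  (* Such an [r] makes $c\alpha_r$ a further inversion of [y], so [c] can be extended by [r] and
     $c^{-1}y$ gets shorter. *)
  have [[r Ir nr]|nex] := pselect (exists2 r, I r & nonneg (- act y^-1 (act c (a_ r))));
    last first.
    exists c => [//|r Ir]; have rr := root_act y^-1 (root_act c (@root_simple R C r)).
    by case: (root_sign rr) => // nr; case: nex; exists r.
  case: (ic) => cy cI cs csV.
  have rc : root (act c (a_ r)) by apply/root_act/root_simple.
  have pc : nonneg (act c (a_ r)).
    have [//|nc] := root_sign rc.
    have /cy/inversionsE[_ _] : Phi c (- act c (a_ r)).
      apply/inversionsE; split; rewrite ?actN ?actK ?opprK //.
        exact: root_opp.
      exact: nonneg_simple.
    by rewrite actN opprK => py; case: (root_signF (root_act y^-1 rc) py nr).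
  have cr := ell_gen_gt pc.
  have cry : Phi (c * cox_gen r)%g `<=` Phi y.
    move=> a /(inversions_mul_gen _ cr)[/cy //|->].
    exact/inversionsE.
  apply: (IH (c * cox_gen r)%g).
    by have /weak_leE := cy; have /weak_leE := cry; rewrite /weak_le; lia.
  split=> // [a|v vI|v vI].
  - case/(inversions_mul_gen _ cr) => [/cI //|->].
    exact/cs/supp_simple.
  - by rewrite actM act_gen; apply/cs/supp_refl.
  - by rewrite invgM cox_genV actM act_gen; apply/supp_refl/csV.
exists c; have cI' r : I r -> Phi c (a_ r).
  move=> Ir; apply: contrapT; rewrite not_inversions; last 2 first.
  - exact: root_simple.
  - exact: nonneg_simple.
  (* A positive $c^{-1}\alpha_r$ combines the two simple roots with nonnegative coefficients, so
     maximality of [c] would make $y^{-1}\alpha_r$ positive. *)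
  move=> pc; have /inversionsE[ry py ny] := yI r Ir.
  apply: (root_signF (root_act y^-1 ry)) => //.
  rewrite -[a_ r](actVK c) -actM; apply: act_nonneg => // s ns.
  rewrite actM; apply: cmax; apply: contraNT ns => Is.
  by rewrite csV //; apply: supp_simple.
split; try by apply: cI'; rewrite /I eqxx ?orbT.
move=> z zt zt' a ca; have [ra pa _] := (inversionsE _ _).1 ca.
apply: inversions_simple_cone => // s ns.
have : I s by apply: contraNT ns => /(cI a ca) ->.
by case/orP => /eqP ->.
Qed.

(** Induction on the length of y: common lower bounds inverting $\alpha_t$ correspond, under left
    multiplication by t, to those of ty and tz. [dihedral_join] reconciles different choices of
    t. *)
Lemma weak_meet y z : exists c, [/\ Phi c `<=` Phi y, Phi c `<=` Phi z &
  forall x, Phi x `<=` Phi y -> Phi x `<=` Phi z -> Phi x `<=` Phi c].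
Proof.
have [n] := ubnP (ell y); elim: n y z => // n IH y z lt_yn.
have meet_t t : Phi y (a_ t) -> Phi z (a_ t) -> exists c,
    [/\ Phi c `<=` Phi y, Phi c `<=` Phi z & forall x, Phi x (a_ t) ->
      Phi x `<=` Phi y -> Phi x `<=` Phi z -> Phi x `<=` Phi c].
  move=> yt zt; have [|c [cy cz cmax]] := IH (cox_gen t * y)%g (cox_gen t * z)%g.
    by have := left_descent_ell yt; lia.
  exists (cox_gen t * c)%g; split=> [||x xt xy xz].
  - by apply: inversions_gen_mul_sub => //; right.
  - by apply: inversions_gen_mul_sub => //; right.
  rewrite -(gen_mulK x t); apply: inversions_gen_mul_sub.
    rewrite gen_mulK; apply: cmax; apply: inversions_gen_mul_sub;
      by [rewrite gen_mulK|left].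
  right; apply/inversions_gen_mul_self => /cy.
  by move/inversions_gen_mul_self; apply.
have [[t [yt zt]]|nt] := pselect (exists t, Phi y (a_ t) /\ Phi z (a_ t)); last first.
  exists 1%g; split=> [a /inversions1 //|a /inversions1 //|x xy xz].
  have [->//|/left_descent_ex[t xt _]] := eqVneq x 1%g.
  by case: nt; exists t; split; [apply: xy|apply: xz].
have [c [cy cz cmax]] := meet_t t yt zt; exists c; split=> // x xy xz.
have [->|/left_descent_ex[r xr _]] := eqVneq x 1%g; first by move=> a /inversions1.
have [yr zr] : Phi y (a_ r) /\ Phi z (a_ r) by split; [apply: xy|apply: xz].
have [d [dy dz dmax]] := meet_t r yr zr.
(* The join of t and r lies below y and z, hence below [d]; so [d] inverts $\alpha_t$ and lies below
   [c]. *)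
have [j [jt jr jmin]] := dihedral_join yt yr.
have dt : Phi d (a_ t) by apply: (dmax j jr) => //; apply: jmin.
by apply: (subset_trans (dmax x xr xy xz)); apply: cmax.
Qed.

(** Apply the letters of a reduced word of w to b one by one: just before the image first turns
    negative, it is a simple root. *)
Lemma act_neg_simple w b : root b -> nonneg b -> nonneg (- act w b) ->
  exists x r, (ell x < ell w)%N /\ act x b = a_ r.
Proof.
move=> rb pb; rewrite -[w]invgK ell_inv; move: w^-1%g => {}w.
elim/ell_ind: w => [|w s ws IH].
  by rewrite invg1 act1 => /(root_signF rb pb).
rewrite invgM cox_genV actM act_gen => nb; rewrite ws.
have rw := root_act w^-1 rb; have [pw|nw] := root_sign rw; last first.
  by have [x [r [xw xb]]] := IH nw; exists x, r; split=> //; lia.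
have [e|ne] := pselect (act w^-1 b = a_ s).
  by exists w^-1%g, s; rewrite ell_inv.
by case: (root_signF (root_refl s rw) (refl_nonneg rw pw ne) nb).
Qed.

(** Depth is measured by the length of an element making the root negative. With $gb=\alpha_r$, the
    image of [refl t b] under g is $\alpha_r-2\langle b,\alpha_t\rangle g\alpha_t$. *)
Lemma depth_refl t b w n : root b -> nonneg b -> b <> a_ t ->
  0 < cox_form b (a_ t) -> (ell w <= n.+1)%N -> nonneg (- act w b) ->
  exists2 x, (ell x <= n)%N & nonneg (- act x (refl t b)).
Proof.
move=> rb pb nbt bt lw /(act_neg_simple rb pb)[g [r [lg gb]]].
have rt := root_act g (@root_simple R C t); have [pt|nt] := root_sign rt.
  (* Here $g\alpha_t$ is positive; if the image were positive too, $g\alpha_t$ would be supported on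
     r, hence equal to $\alpha_r=gb$. *)
  exists g; first by lia.
  have [pr|//] := root_sign (root_act g (root_refl t rb)).
  case: nbt; apply: (can_inj (actK g)); rewrite gb; apply/esym.
  apply: root_simple_eq => // s sr; apply/eqP; rewrite eq_le pt andbT.
  have := pr s; rewrite /refl actB actZ gb !ffunE (negbTE sr) sub0r oppr_ge0.
  by rewrite pmulr_rle0 // mulr_gt0.
(* Here $gt$ is shorter than g, which leaves room for the letter r that turns $\alpha_r$
   negative. *)
exists (cox_gen r * (g * cox_gen t))%g.
  have := ell_mul_le (cox_gen r) (g * cox_gen t)%g; have := ell_gen_le r.
  by have := ell_gen_lt nt; lia.
rewrite !actM !act_gen reflK gb refl_self opprK; exact: nonneg_simple.
Qed.

(** Some term of $1=\langle b,b\rangle=\sum_t b_t\langle b,\alpha_t\rangle$ is positive, and $b_t\ge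
    0$. *)
Lemma root_form_gt0 b : root b -> nonneg b -> exists t, 0 < cox_form b (a_ t).
Proof.
move=> rb pb; apply: contrapT => nt; have := ltr01 (R := R).
rewrite -(cox_form_root rb) ltNge => /negP; apply.
rewrite /cox_form exchange_big sumr_le0 // => t _.
have -> : \sum_s b s * b t * cox_form_coef R s t = b t * cox_form b (a_ t).
  by rewrite cox_form_simple mulr_sumr; apply: eq_bigr => s _; ring.
rewrite mulr_ge0_le0 // leNgt; apply/negP => h; by case: nt; exists t.
Qed.

Lemma common_witness_meet x y z b : root b -> nonneg b ->
  (forall a, Phi x a /\ Phi y a <-> a = b) ->
  (forall a, Phi x a /\ Phi z a <-> a = b) ->
  exists c, [/\ Phi c b, Phi c `<=` Phi y & Phi c `<=` Phi z].
Proof.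
move=> rb pb.
have [n [w lw nw]] : exists n, exists2 w, (ell w <= n)%N & nonneg (- act w b).
  case: (rb) => w [s bE]; exists (ell (cox_gen s * w^-1)%g), (cox_gen s * w^-1)%g => //.
  by rewrite actM bE actK act_gen refl_self opprK; apply: nonneg_simple.
elim: n b w x y z rb pb lw nw => [|n IH] b w x y z rb pb lw nw.
  move: nw; rewrite (@ell_eq0 _ w) ?act1; last by lia.
  by move/(root_signF rb pb).
move=> xy xz; have [xb yb] : Phi x b /\ Phi y b by apply/xy.
have [_ zb] : Phi x b /\ Phi z b by apply/xz.
have [t bt] := root_form_gt0 rb pb; have [bE|nbt] := pselect (b = a_ t).
  exists (cox_gen t); split=> [|a|a]; rewrite inversions_gen -bE //; by move=> ->.
have [w' lw' nw'] := depth_refl rb pb nbt bt lw nw.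
set b' := refl t b in nw' *; have rb' : root b' := root_refl t rb.
have pb' : nonneg b' := refl_nonneg rb pb nbt.
have nb't : b' <> a_ t.
  move/(congr1 (refl t)); rewrite reflK refl_self => e.
  by apply: (root_signF rb pb); rewrite e opprK; apply: nonneg_simple.
have rt : root (a_ t) := root_simple R t; have pt := @nonneg_simple R C t.
have bE : b = b' + (2 * cox_form b (a_ t)) *: a_ t by rewrite /b' /refl subrK.
have coclosed p : Phi p b -> Phi p b' \/ Phi p (a_ t).
  move=> /inversionsE[_ _ np]; apply: contrapT => /not_orP[nb nt].
  have := (not_inversions p rb' pb').1 nb; have := (not_inversions p rt pt).1 nt.
  move=> h1 h2; apply: (root_signF (root_act p^-1 rb)) => //.
  rewrite {}bE actD actZ => s; rewrite !ffunE addr_ge0 // mulr_ge0 //.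
  by rewrite mulr_ge0 ?ltW.
have nbb' : b' <> b.
  move=> e; move/ffunP: bE => /(_ t); rewrite e !ffunE eqxx => /eqP.
  rewrite addrC -subr_eq subrr eq_sym /GRing.scale /= mulr1 mulf_eq0 pnatr_eq0 /=.
  by rewrite gt_eqF.
have side q : (forall a, Phi x a /\ Phi q a <-> a = b) ->
    Phi x (a_ t) <-> ~ Phi q (a_ t).
  move=> xq; have [_ qb] : Phi x b /\ Phi q b by apply/xq.
  split=> [xt qt|nqt]; first by case: nbt; apply/esym/xq.
  have [qb'|//] := coclosed q qb; have [xb'|//] := coclosed x xb.
  by case: nbb'; apply/xq.
(* By [side], $\alpha_t$ lies in exactly one of the two inversion sets; toggling it in both keeps it
   out of the intersection. *)
have step q : (forall a, Phi x a /\ Phi q a <-> a = b) ->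
    forall a, Phi (cox_gen t * x)%g a /\ Phi (cox_gen t * q)%g a <-> a = b'.
  move=> xq a; have [->|nat] := pselect (a = a_ t).
    rewrite !inversions_gen_mul_self; have := side q xq.
    by split=> [[]|e]; [tauto|case: nb't].
  split=> [[xa qa]|->].
    have [ra pa _] := (inversionsE _ _).1 xa.
    move: xa qa; rewrite !inversions_gen_mul // => xa qa.
    by rewrite /b' -(proj1 (xq (refl t a))) ?reflK.
  rewrite !inversions_gen_mul // /b' reflK; exact/xq.
have [c' [c'b' c'y c'z]] := IH b' w' _ _ _ rb' pb' lw' nw' (step y xy) (step z xz).
(* The bound [c'] need not invert $\alpha_t$. The meet [d] lies above [c'] and inverts $\alpha_t$
   whenever [y] does not, as is needed to bring td below y and z. *)
have [d [dy dz dmax]] := weak_meet (cox_gen t * y)%g (cox_gen t * z)%g.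
have yz : Phi y (a_ t) <-> Phi z (a_ t).
  have := side y xy; have := side z xz.
  by have [] := pselect (Phi y (a_ t)); have [] := pselect (Phi z (a_ t)); tauto.
have dt : Phi d (a_ t) \/ Phi y (a_ t).
  have [yt|nyt] := pselect (Phi y (a_ t)); first by right.
  left; apply: (dmax (cox_gen t)); rewrite ?inversions_gen // => a;
    rewrite inversions_gen => ->; apply/inversions_gen_mul_self; tauto.
exists (cox_gen t * d)%g; split.
- rewrite inversions_gen_mul //; exact: (dmax c').
- exact: inversions_gen_mul_sub.
- by apply: inversions_gen_mul_sub => //; rewrite -yz.
Qed.
End WeakOrder.

(** * Boundary witnesses and cone types *)

Section BoundaryWitnesses.
Variables (R : realType) (C : coxeterSystem).
Local Notation a_ := (simple_root R).
Local Notation Phi := (@inversions R C).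
Implicit Types (T : set C) (w x y z v : C) (s : cox_gens C) (a b : cox_space R C).

Lemma boundary_witnessE x b y :
  boundary_witness x b y <-> forall a, Phi x a /\ Phi y a <-> a = b.
Proof.
split=> [xyb a|xyb]; last first.
  by apply/seteqP; split=> [a [xa ya]|_ ->]; apply/xyb.
have -> : (Phi x a /\ Phi y a) = (Phi x `&` Phi y) a by [].
by rewrite xyb.
Qed.

(** Membership in T can be tested on any x in Q(T), which is how information passes from one such x
    to another. *)
Lemma cone_part_inversions T x v : cone_part T x ->
  T v <-> forall a, ~ (Phi x a /\ Phi v a).
Proof.
by move=> <-; have := ell_mul_inversions R (x^-1)%g v; rewrite invgK.
Qed.

Lemma weak_le_ell_eq x y : weak_le x y -> (ell y <= ell x)%N -> x = y.
Proof.
rewrite /weak_le => xy yx; have /ell_eq0 e : ell (x^-1 * y)%g = 0%N by lia.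
by apply: (mulgI x^-1%g); rewrite e mulVg.
Qed.

Lemma min_length_ex (A : set C) y : A y -> exists z, min_length_in A z.
Proof.
move=> Ay; have ex : exists n, `[< exists2 z, A z & ell z = n >].
  by exists (ell y); apply/asboolP; exists y.
case: (ex_minnP ex) => n /asboolP[z Az zn] nmin; exists z; split=> // u Au.
by rewrite zn; apply: nmin; apply/asboolP; exists u.
Qed.

Lemma min_witness_descent x b y s : min_length_in (boundary_witness x b) y ->
  right_descent y s -> b = - act y (a_ s).
Proof.
case=> /boundary_witnessE xyb ymin ys; apply: contrapT => nb.
suff /ymin : boundary_witness x b (y * cox_gen s)%g by rewrite -ys ltnn.
apply/boundary_witnessE => a.
have := @inversions_mul_gen R C (y * cox_gen s)%g s a.
rewrite mul_genK actM act_gen refl_self actN => /(_ (esym ys)) yE.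
split=> [[xa ya]|ab]; first by apply/xyb; split=> //; apply/yE; left.
by have [xa /yE[]//] := (xyb a).2 ab; rewrite ab => /nb.
Qed.

Lemma min_witness_cone_part T x x' b y : cone_part T x -> cone_part T x' ->
  min_length_in (boundary_witness x b) y -> boundary_witness x' b y.
Proof.
move=> Tx Tx' ymin; have [/boundary_witnessE xyb _] := ymin.
have [xb yb] := (xyb b).2 erefl.
have [|s ys] := @ell_gt0_descent _ y.
  by rewrite lt0n; apply: contra_notN (@inversions1 R C b) => /eqP/ell_eq0 <-.
have bE := min_witness_descent ymin (esym ys).
pose v := (y * cox_gen s)%g.
have yE a : Phi y a <-> Phi v a \/ a = b.
  rewrite -(mul_genK y s) inversions_mul_gen ?mul_genK //.
  by rewrite actM act_gen refl_self actN -bE.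
have nvb : ~ Phi v b.
  have -> : b = act v (a_ s) by rewrite actM act_gen refl_self actN.
  case/inversionsE => _ _; rewrite actK => h.
  by apply: (root_signF (root_simple R s)) => //; apply: nonneg_simple.
have Tv : T v.
  apply/(cone_part_inversions v Tx) => a [xa va]; apply: nvb.
  by rewrite -(proj1 (xyb a)) //; split=> //; apply/yE; left.
have nTy : ~ T y by move/(cone_part_inversions y Tx)/(_ b); apply.
have x'v := (cone_part_inversions v Tx').1 Tv.
(* The only root of $\Phi(y)$ outside $\Phi(v)$ is b, so $b\notin\Phi(x')$ would put [y] into T. *)
have x'b : Phi x' b.
  apply: contrapT => nx'b; apply/nTy/(cone_part_inversions y Tx') => a [xa].
  by case/yE => [va|ab]; [apply: (x'v a)|apply: nx'b; rewrite -ab].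
apply/boundary_witnessE => a; split=> [[xa /yE[va|//]]|->//].
by case: (x'v a).
Qed.

End BoundaryWitnesses.

Theorem corollary1 (R : realType) (C : coxeterSystem) (T : set C)
    (hT : cone_types T) (beta : cox_space R C)
    (hbeta : cone_boundary T beta) :
  exists y_beta : C,
    [/\ unique (min_length_in (cone_boundary_at T beta)) y_beta,
        right_descent_roots y_beta = [set beta],
        forall x : C, cone_part T x ->
          forall y : C, boundary_witness x beta y -> weak_le y_beta y
      & forall y : C, cone_boundary_at T beta y -> weak_le y_beta y].
Proof.
(* [y] is chosen minimal for the single element [x0]; [y_in] then makes it a witness for all of
   Q(T). *)
have [[rb pb] [x0 Tx0 [y0 /min_length_ex[y ymin]]]] := hbeta.
have y_in x : cone_part T x -> boundary_witness x beta y.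
  by move=> Tx; apply: min_witness_cone_part Tx0 Tx ymin.
have [/boundary_witnessE x0y y_le] := ymin.
have [x0b yb] := (x0y beta).2 erefl.
have y_weak x : cone_part T x ->
    forall z, boundary_witness x beta z -> weak_le y z.
  move=> Tx z /boundary_witnessE xz.
  have /boundary_witnessE xy := y_in x Tx.
  have [c [cb cy cz]] := common_witness_meet rb pb xy xz.
  (* The lower bound [c] is tested against [x0], where [y] is minimal: $\Phi(c)$ contains beta and
     lies in $\Phi(y)$, so [c] is a witness for [x0] and equals [y]. *)
  have /y_le : boundary_witness x0 beta c.
    apply/boundary_witnessE => a; split=> [[xa /cy ya]|->//].
    exact/x0y.
  by move/weak_le_ell_eq => <-; apply/(weak_leE R).
have y_weak' z : cone_boundary_at T beta z -> weak_le y z.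
  by move=> /(_ _ Tx0); apply: y_weak.
exists y; split=> //.
- split=> [|z [zb zmin]].
    by split=> // z /y_weak'; rewrite /weak_le => ->; rewrite leq_addr.
  by apply: weak_le_ell_eq; [apply: y_weak'|apply: zmin].
- apply/seteqP; split=> [_ [s ys <-]|_ ->] /=.
    by rewrite -(min_witness_descent ymin ys).
  have [|s ys] := @ell_gt0_descent _ y.
    by rewrite lt0n; apply: contra_notN (@inversions1 R C beta) => /eqP/ell_eq0 <-.
  by exists s; rewrite /= -?(min_witness_descent ymin (esym ys)).
Qed.
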